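(* For each nonnegative integer $k$, $|\mathcal U_{2k+1}(321)|=C_k$, where $C_k=\frac{1}{k+1}\binom{2k}{k}$.
   Context: The stack-sorting map $s$ on permutations (finite words of distinct positive integers): $s(\text{empty})=\text{empty}$, and if $\pi=LnR$ with $n$ the largest entry, $s(\pi)=s(L)s(R)n$. A permutation is uniquely sorted if it has exactly one preimage under $s$. A permutation avoids $\tau$ if no subsequence has the same relative order as $\tau$; $\mathcal U_n(\tau)$ is the set of uniquely sorted permutations of $[n]$ avoiding $\tau$. *)

(* Defs.v *)
From mathcomp Require Import all_boot.
From mathcomp Require Import classical_sets functions cardinality.

Set Implicit Arguments.
Unset Strict Implicit.
Unset Printing Implicit Defensive.

Local Open Scope nat_scope.

Definition is_permutation (w : seq nat) : bool :=
  uniq w && all (fun x => 0 < x) w.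

Definition is_permutation_of (n : nat) (w : seq nat) : bool :=
  perm_eq w (iota 1 n).

(* The recursion of the stack-sorting map, on a word w of size at most fuel.
   Its defining equations are stack_sort_nil and stack_sort_cat below. *)
Fixpoint stack_sort_rec (fuel : nat) (w : seq nat) : seq nat :=
  match fuel, w with
  | fuel'.+1, _ :: _ =>
      let n := \max_(x <- w) x in
      let i := index n w in
      stack_sort_rec fuel' (take i w)
        ++ stack_sort_rec fuel' (drop i.+1 w) ++ [:: n]
  | _, _ => [::]
  end.

Definition stack_sort (w : seq nat) : seq nat := stack_sort_rec (size w) w.

Definition uniquely_sorted (w : seq nat) : Prop :=
  exists! v : seq nat, is_permutation v /\ stack_sort v = w.

Definition same_relative_order (u v : seq nat) : Prop :=
  size u = size v /\
  forall i j, i < size u -> j < size u ->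
    (nth 0 u i < nth 0 u j) = (nth 0 v i < nth 0 v j).

Definition avoids (tau w : seq nat) : Prop :=
  ~ exists2 u : seq nat, subseq u w & same_relative_order u tau.

Definition uniquely_sorted_avoiding (n : nat) (tau : seq nat) : set (seq nat) :=
  [set w | [/\ is_permutation_of n w, uniquely_sorted w & avoids tau w]]%classic.

(* The quotient is exact: see catalanE. *)
Definition catalan (k : nat) : nat := 'C(2 * k, k) %/ k.+1.

Lemma catalanE k : k.+1 * catalan k = 'C(2 * k, k).
Proof.
rewrite /catalan mulnC divnK // -(@Gauss_dvdr _ k) ?coprimeSn //.
have := mul_bin_left (2 * k) k.
by rewrite mul2n -addnn addnK => <-; exact: dvdn_mulr.
Qed.

Lemma stack_sort_nil : stack_sort [::] = [::].
Proof. by []. Qed.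

Lemma stack_sort_rec_fuel f w : size w <= f ->
  stack_sort_rec f w = stack_sort w.
Proof.
rewrite /stack_sort; move: (leqnn (size w)); move: {2 4}(size w) => g.
elim: f g w => [|f IH] [|g] [|x w] // wg wf.
rewrite [LHS]/= [RHS]/=; set i := if _ then _ else _.
have li : i <= size w.
  rewrite -ltnS -[i]/(index (\max_(y <- x :: w) y) (x :: w)) index_mem.
  elim: w x {wg wf i} => [|y s IHs] x; first by rewrite big_seq1 mem_head.
  rewrite big_cons in_cons /maxn; case: ifP => _; first by rewrite IHs orbT.
  by rewrite eqxx.
rewrite !ltnS in wg wf.
have tk : size (take i (x :: w)) = i by rewrite size_takel // ltnW.
have dr : size (drop i w) <= size w by rewrite size_drop leq_subr.
by congr (_ ++ (_ ++ _)); apply: IH; rewrite ?tk ?(leq_trans li) ?(leq_trans dr).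
Qed.

Lemma stack_sort_cat L n R : all (fun x => x < n) (L ++ R) ->
  stack_sort (L ++ n :: R) = stack_sort L ++ stack_sort R ++ [:: n].
Proof.
rewrite all_cat => /andP[/allP Ln /allP Rn].
have maxE : \max_(x <- L ++ n :: R) x = n.
  apply/eqP; rewrite eqn_leq; apply/andP; split.
    apply/bigmax_leqP_seq => x; rewrite mem_cat in_cons => + _.
    by case/or3P => [/Ln/ltnW|/eqP->|/Rn/ltnW].
  by apply: (@leq_bigmax_seq _ _ predT id); rewrite ?mem_cat ?mem_head ?orbT.
have iE : index n (L ++ n :: R) = size L.
  rewrite index_cat /= eqxx addn0 ifN //; apply/negP => /Ln.
  by rewrite ltnn.
have stepE w f : w != [::] -> stack_sort_rec f.+1 w =
    stack_sort_rec f (take (index (\max_(x <- w) x) w) w) ++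
    stack_sort_rec f (drop (index (\max_(x <- w) x) w).+1 w) ++
    [:: \max_(x <- w) x] by case: w.
rewrite {1}/stack_sort size_cat /= addnS stepE; last by case: (L).
rewrite maxE iE take_size_cat // -(cat_rcons n L R) drop_size_cat ?size_rcons //.
by rewrite !stack_sort_rec_fuel ?(leq_addl, leq_addr).
Qed.

(* Main.v *)
Require Import Defs.
From mathcomp Require Import all_boot.
From mathcomp Require Import classical_sets functions cardinality.
From mathcomp Require Import zify.

(** Write a word as [v = L n R] with [n] the largest letter, so that
[s v = s L s R n].  If [s v] is uniquely sorted then so are [s L] and [s R], and
unless [v = n] the word [s L] contains a letter larger than the first letter of
[s R]: otherwise [s (L R) = s L s R], and both [n L R] and [L R n] would be
preimages of [s v].  A uniquely sorted word of length at least 3 starts with a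
descent, so that avoidance of 321 forces [s R] to be a single letter.  By
induction [s v = o_1 e_1 o_2 e_2 ... o_k e_k n], where [o] and [e] are increasing
and [e_i < o_i].  Conversely each such word avoids 321, and peeling off the
last two letters shows that it has exactly one preimage.  The pairs [(e, o)]
with letters [1, ..., 2k] are the standard Young tableaux of shape [(k, k)],
which are counted by the ballot recurrence. *)

Set Implicit Arguments.
Unset Strict Implicit.
Unset Printing Implicit Defensive.

Local Open Scope nat_scope.

(** * The stack-sorting map *)

Lemma is_permutation_cat_cons L n R : is_permutation (L ++ n :: R) ->
  [/\ is_permutation L, is_permutation R & is_permutation (L ++ R)].
Proof.
move=> /andP[]; rewrite cat_uniq all_cat /= negb_or.
case/and3P=> uL /andP[_ hLR] /andP[_ uR] /and3P[pL _ pR].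
by split; rewrite /is_permutation ?cat_uniq ?all_cat ?uL ?uR ?pL ?pR ?hLR.
Qed.

Lemma is_permutation_perm u v : perm_eq u v ->
  is_permutation u = is_permutation v.
Proof. by move=> uv; rewrite /is_permutation (perm_uniq uv) (perm_all _ uv). Qed.

Lemma seq_max_split (v : seq nat) : uniq v -> v != [::] ->
  exists L n R, v = L ++ n :: R /\ all (fun x => x < n) (L ++ R).
Proof.
case: v => // x s; set v := x :: s => uv _.
pose n := \max_(y <- v) y.
have nv : n \in v.
  rewrite /n /v; elim: (s) (x) => [|y t IH] z.
    by rewrite big_seq1 mem_head.
  rewrite big_cons in_cons /maxn; case: ifP => _; first by rewrite IH orbT.
  by rewrite eqxx.
have le y : y \in v -> y <= n by move=> yv; apply: (@leq_bigmax_seq _ _ predT id).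
move: n nv le => n nv; case/path.splitP: nv uv => L R uv le.
exists L, n, R; split=> [|]; first by rewrite cat_rcons.
have := uv; rewrite cat_uniq rcons_uniq.
case/and3P=> /andP[nL _] /hasPn nR _.
apply/allP => y yLR; rewrite ltn_neqAle le ?andbT //; last first.
  by move: yLR; rewrite cat_rcons !mem_cat in_cons => /orP[] ->; rewrite ?orbT.
apply/eqP => yn; move: yLR; rewrite yn mem_cat (negbTE nL) /= => /nR.
by rewrite mem_rcons mem_head.
Qed.

(** Strong induction on length along the splitting at the largest letter, that is, along the
    recursion of the map itself. *)
Lemma perm_word_ind (P : seq nat -> Prop) : P [::] ->
  (forall L n R, all (fun x => x < n) (L ++ R) ->
     is_permutation L -> is_permutation R -> is_permutation (L ++ n :: R) ->
     P L -> P R -> P (L ++ n :: R)) ->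
  forall v, is_permutation v -> P v.
Proof.
move=> P0 PS v; move: {2}(size v) (leqnn (size v)) => m.
elim: m v => [|m IH] v sv pv; first by case: v sv pv.
have [->//|v0] := eqVneq v [::].
have /andP[uv _] := pv.
have [L [n [R [vE hall]]]] := seq_max_split uv v0; rewrite vE in pv sv *.
have [pL pR _] := is_permutation_cat_cons pv.
move: sv; rewrite size_cat /= => sv.
by apply: PS => //; apply: IH => //; lia.
Qed.

Lemma stack_sort_perm v : is_permutation v -> perm_eq (stack_sort v) v.
Proof.
move: v; apply: perm_word_ind => // L n R hall pL pR p hL hR.
by rewrite stack_sort_cat // perm_cat // cats1 perm_rcons perm_cons.
Qed.

Lemma stack_sort_is_permutation v : is_permutation v ->
  is_permutation (stack_sort v).
Proof. by move=> pv; rewrite (is_permutation_perm (stack_sort_perm pv)). Qed.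

Lemma stack_sort_eq_nil v : is_permutation v -> stack_sort v = [::] -> v = [::].
Proof.
by move=> pv e; apply/nilP; rewrite /nilp -(perm_size (stack_sort_perm pv)) e.
Qed.

Lemma stack_sort_eq_seq1 v x : is_permutation v -> stack_sort v = [:: x] ->
  v = [:: x].
Proof.
move=> pv e; have := stack_sort_perm pv; rewrite e perm_sym.
exact: perm_small_eq.
Qed.

(** The last letter of an image is the largest letter of its preimage, so it tells where the
    preimage splits. Uniqueness of preimages is read off from this. *)
Lemma stack_sort_last_max v u n : is_permutation v -> stack_sort v = rcons u n ->
  exists L R, [/\ v = L ++ n :: R, all (fun x => x < n) (L ++ R),
    u = stack_sort L ++ stack_sort R, is_permutation L & is_permutation R].
Proof.
move: v; apply: perm_word_ind => [|L N R hall pL pR pv _ _].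
  by rewrite stack_sort_nil; case: u.
by rewrite stack_sort_cat // catA cats1 => /rcons_inj[<- <-]; exists L, R.
Qed.

(** The largest letter [n] of [B = L n R] is at least the first letter of its image, hence exceeds
    all of [A]: the split of [A ++ B] only enlarges [L] to [A ++ L]. If [L] is not empty, its image
    starts with the same letter as that of [B], and induction applies. Used contrapositively, to
    find a large letter in [A]. *)
Lemma stack_sort_cat_lt A B : is_permutation A -> is_permutation B ->
  all (fun x => x < head 0 (stack_sort B)) A ->
  stack_sort (A ++ B) = stack_sort A ++ stack_sort B.
Proof.
move=> pA pB; move: B pB; apply: perm_word_ind.
  by rewrite stack_sort_nil !cats0.
move=> L n R hall pL pR p hL _.
have hd : head 0 (stack_sort (L ++ n :: R)) <= n.
  have ps := stack_sort_perm p; move: (ps); rewrite stack_sort_cat //.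
  case E: (_ ++ _ ++ [:: n]) => [|z t] //= ps'.
  have : z \in L ++ n :: R by rewrite -(perm_mem ps') mem_head.
  rewrite mem_cat in_cons orbCA -mem_cat.
  by case/orP => [/eqP->//|/(allP hall)/ltnW].
move=> hA; have hAn : all (fun x => x < n) ((A ++ L) ++ R).
  rewrite -catA all_cat hall andbT; by apply: sub_all hA => x hx; apply: leq_trans hx hd.
rewrite catA !stack_sort_cat // [RHS]catA; congr (_ ++ _).
have [->|L0] := eqVneq L [::]; first by rewrite stack_sort_nil !cats0.
apply: hL; move: hA; rewrite stack_sort_cat //.
case E: (stack_sort L) => [|z t] //.
by rewrite (stack_sort_eq_nil pL E) in L0.
Qed.

(** * Uniquely sorted words avoiding 321 *)

Lemma avoids_321 w : avoids [:: 3; 2; 1] w <->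
  forall a b c, subseq [:: a; b; c] w -> b < a -> c < b -> False.
Proof.
split=> [av a b c abc ba cb|H [u uw [su hu]]].
  apply: av; exists [:: a; b; c] => //; split=> // i j.
  by case: i => [|[|[|i]]] // _; case: j => [|[|[|j]]] // _ /=; lia.
case: u uw su hu => [|a [|b [|c []]]] // uw _ hu.
by apply: (H _ _ _ uw); [rewrite (hu 1 0) | rewrite (hu 2 1)].
Qed.

Lemma avoids_subseq tau u w : subseq u w -> avoids tau w -> avoids tau u.
Proof. by move=> uw av [x xu xt]; apply: av; exists x => //; apply: subseq_trans uw. Qed.

(** * Interleavings of two increasing words *)

(** The names recall positions: [o] fills the odd ones and [e] the even ones. *)
Fixpoint weave (o e : seq nat) : seq nat :=
  if o is x :: o' then if e is y :: e' then x :: y :: weave o' e' else [::]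
  else [::].

Lemma weave_rcons o e x y : size e = size o ->
  weave (rcons o x) (rcons e y) = weave o e ++ [:: x; y].
Proof. by elim: o e => [|a o IH] [|b e] //= [/IH->]. Qed.

Lemma perm_weave o e : size e = size o -> perm_eq (weave o e) (e ++ o).
Proof.
elim: o e => [|a o IH] [|b e] //= [/IH h].
apply/permP => f; rewrite /= count_cat /= (permP h) count_cat.
by rewrite addnCA; congr (_ + _); rewrite addnCA.
Qed.

Lemma subseq_weave o e : size e = size o ->
  subseq o (weave o e) && subseq e (weave o e).
Proof.
elim: o e => [|a o IH] [|b e] //= [/IH /andP[h1 h2]]; rewrite eqxx /=.
apply/andP; split; first exact: subseq_trans (subseq_cons _ _).
by case: ifP => _; rewrite ?eqxx //; apply: subseq_trans (subseq_cons _ _).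
Qed.

Lemma weave_inj o e o' e' : size e = size o -> size e' = size o' ->
  weave o e = weave o' e' -> o = o' /\ e = e'.
Proof.
elim: o e o' e' => [|a o IH] [|b e] [|a' o'] [|b' e'] //= [h] [h'] [-> ->].
by case/(IH _ _ _ h h') => -> ->.
Qed.

(** The column condition of a tableau with rows [e] and [o]. Past the end of [e] the default 0 makes
    it weak, so a comparison of sizes accompanies it. *)
Definition dominated (e o : seq nat) : Prop :=
  forall i, i < size o -> nth 0 e i < nth 0 o i.

Lemma dominated_rcons e o y x : size e = size o ->
  dominated (rcons e y) (rcons o x) <-> dominated e o /\ y < x.
Proof.
move=> eo; split=> [d|[d yx] i]; rewrite ?size_rcons ?ltnS.
  split=> [i io|]; first by have := d i; rewrite size_rcons !nth_rcons eo io ltnS (ltnW io); apply.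
  by have := d (size o); rewrite size_rcons !nth_rcons eo ltnn eqxx; apply.
by rewrite !nth_rcons eo; case: (ltngtP i) => // io _; apply: d.
Qed.

Lemma sorted_ltn_rcons s x :
  sorted ltn (rcons s x) = sorted ltn s && all (fun y => y < x) s.
Proof.
rewrite !(sorted_pairwise ltn_trans) -cats1 pairwise_cat /= andbT andbC.
by congr (_ && _); apply: eq_in_all => y _; rewrite /= andbT.
Qed.

(** The normal form of the words to be counted. Appending [m] to [o] in the sortedness condition
    makes [m] the largest letter. *)
Definition zigzag (w e o : seq nat) (m : nat) : Prop :=
  [/\ size e = size o, w = rcons (weave o e) m, sorted ltn (rcons o m),
      sorted ltn e & dominated e o].

(** Growth by two letters: the former last letter [m] joins the odd row, and [x] becomes its smaller
    partner in the even row. *)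
Lemma zigzag_step w e o m x n : zigzag w e o m -> x < m -> m < n ->
  all (fun y => y < x) e ->
  zigzag (w ++ [:: x; n]) (rcons e x) (rcons o m) n.
Proof.
case=> eo wE so se d xm mn ex; split; first by rewrite !size_rcons eo.
- by rewrite weave_rcons // wE -!cats1 -!catA.
- rewrite sorted_ltn_rcons so /= all_rcons mn /=.
  move: so; rewrite sorted_ltn_rcons => /andP[_].
  by apply: sub_all => y /ltn_trans; apply.
- by rewrite sorted_ltn_rcons se.
- by apply/dominated_rcons.
Qed.

Lemma zigzag_unstep w e o m x n :
  zigzag w (rcons e x) (rcons o m) n ->
  [/\ exists2 u, zigzag u e o m & w = u ++ [:: x; n],
      x < m, m < n & all (fun y => y < x) e].
Proof.
case; rewrite !size_rcons => -[eo] wE so.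
rewrite sorted_ltn_rcons => /andP[se ex] /(dominated_rcons _ _ eo)[d xm].
move: so; rewrite (sorted_ltn_rcons _ n) all_rcons => /and3P[so mn _]; split=> //.
exists (rcons (weave o e) m); first by split.
by rewrite wE weave_rcons // -!cats1 -!catA.
Qed.

Lemma zigzag_max w e o m : zigzag w e o m -> all (fun y => y < m) (e ++ o).
Proof.
case=> eo _ so _ d; move: so; rewrite sorted_ltn_rcons => /andP[_ om].
rewrite all_cat om andbT; apply/(all_nthP 0) => i; rewrite eo => io.
exact: ltn_trans (d _ io) (all_nthP 0 om _ io).
Qed.

Lemma zigzag_perm w e o m : zigzag w e o m -> perm_eq w (m :: (e ++ o)).
Proof. by case=> eo -> _ _ _; rewrite perm_rcons perm_cons perm_weave. Qed.

(** * Uniquely sorted words avoiding 321 are zigzags *)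

(** Replacing [L] or [R] by a word with the same image, or moving [n] within the word without
    changing the image of the rest, would produce a second preimage. *)
Lemma uniquely_sorted_catl L R n : is_permutation (L ++ n :: R) ->
  all (fun x => x < n) (L ++ R) ->
  uniquely_sorted (stack_sort (L ++ n :: R)) ->
  [/\ uniquely_sorted (stack_sort L), uniquely_sorted (stack_sort R)
    & L ++ R = [::] \/ stack_sort (L ++ R) != stack_sort L ++ stack_sort R].
Proof.
move=> p hall [v [_ vU]].
have [pL pR pLR] := is_permutation_cat_cons p.
have vE := vU _ (conj p erefl).
(* Any other way to place [n] between words [A] and [B] with the same letters and the same joint
   image is again a preimage, hence the given one. *)
have alt A B : perm_eq (A ++ B) (L ++ R) ->
    stack_sort A ++ stack_sort B = stack_sort L ++ stack_sort R ->
    L ++ n :: R = A ++ n :: B.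
  move=> AB sAB; rewrite -vE; apply: vU; split.
    rewrite (is_permutation_perm (v := L ++ n :: R)) //.
    by rewrite -cat1s perm_catCA /= perm_sym -cat1s perm_catCA /= perm_cons perm_sym.
  by rewrite !stack_sort_cat ?catA ?sAB // (perm_all _ AB).
have size_eq A B : is_permutation A -> is_permutation B ->
    stack_sort A = stack_sort B -> size B = size A.
  move=> pA pB AB.
  by rewrite -(perm_size (stack_sort_perm pA)) AB (perm_size (stack_sort_perm pB)).
have perm_of A B : is_permutation A -> is_permutation B ->
    stack_sort A = stack_sort B -> perm_eq A B.
  move=> pA pB AB; have := stack_sort_perm pA; rewrite AB perm_sym.
  by move=> /perm_trans; apply; apply: stack_sort_perm.
split.
- exists L; split=> // A [pA sA]; have := alt A R.
  rewrite perm_cat2r sA => /(_ (perm_of _ _ pA pL sA) erefl)/eqP.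
  by rewrite eqseq_cat ?(size_eq A L) // => /andP[/eqP].
- exists R; split=> // A [pA sA]; have := alt L A.
  rewrite perm_cat2l sA => /(_ (perm_of _ _ pA pR sA) erefl)/eqP.
  by rewrite eqseq_cat // eqxx => /eqP[].
- have [|LR0] := eqVneq (L ++ R) [::]; [by left | right].
  apply/eqP => sLR.
  (* With [n] in front of [L ++ R] and with [n] behind it, both words are preimages. Being equal,
     they force the first letter of [L ++ R] to be [n]. *)
  have e1 := alt [::] (L ++ R) (perm_refl _) sLR.
  have := alt (L ++ R) [::]; rewrite cats0 => /(_ (perm_refl _)).
  rewrite sLR stack_sort_nil cats0 e1 => /(_ erefl).
  case E: (L ++ R) LR0 => [|z t] // _ [nz _].
  by move: hall; rewrite E -nz /= ltnn.
Qed.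

Lemma zigzag_of_uniquely_sorted v : is_permutation v -> v != [::] ->
  uniquely_sorted (stack_sort v) -> avoids [:: 3; 2; 1] (stack_sort v) ->
  exists e o m, zigzag (stack_sort v) e o m.
Proof.
move: v; apply: perm_word_ind => // L n R hall pL pR p IHL IHR _ us av.
have [usL usR splitLR] := uniquely_sorted_catl p hall us.
move: av; rewrite stack_sort_cat // => av.
case: splitLR => [LR0|neq].
  have [-> ->] : L = [::] /\ R = [::] by case: (L) LR0 => //=; case: (R).
  by exists [::], [::], n; split=> // i.
have R0 : R != [::].
  by apply: contraNneq neq => ->; rewrite stack_sort_nil !cats0.
have L0 : L != [::] by apply: contraNneq neq => ->; rewrite stack_sort_nil.
have avL : avoids [:: 3; 2; 1] (stack_sort L).
  by apply: avoids_subseq av; apply: prefix_subseq.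
have avR : avoids [:: 3; 2; 1] (stack_sort R).
  apply: avoids_subseq av; apply: subseq_trans (suffix_subseq _ _).
  exact: prefix_subseq.
have [e [o [m zL]]] := IHL L0 usL avL.
have [e' [o' [x zR]]] := IHR R0 usR avR.
(* Since the images of [L] and [R] do not simply concatenate, some [y] in [L] is at least the first
   letter of the image of [R]. *)
have {neq} /allPn[y yL] : ~~ all (fun x => x < head 0 (stack_sort R)) L.
  by apply: contraNN neq => h; rewrite stack_sort_cat_lt.
rewrite -leqNgt => hy.
have ysL : y \in stack_sort L by rewrite (perm_mem (stack_sort_perm pL)).
have pstack : is_permutation (stack_sort L ++ stack_sort R ++ [:: n]).
  by rewrite -stack_sort_cat //; apply: stack_sort_is_permutation.
move/avoids_321: av => av.
have sub3 a b c : a \in stack_sort L -> subseq [:: b; c] (stack_sort R) ->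
    subseq [:: a; b; c] (stack_sort L ++ stack_sort R ++ [:: n]).
  move=> aL bc; rewrite -[[:: a; b; c]]/([:: a] ++ [:: b; c]).
  by apply: cat_subseq; [rewrite sub1seq | apply: subseq_trans bc (prefix_subseq _ _)].
(* A longer zigzag starts with a descent [b c], and [y b c] would be a 321 pattern. Distinctness of
   the letters makes [b < y] strict. *)
have sRE : stack_sort R = [:: x].
  case: o' zR => [|b o'] zR; first by case: zR => /size0nil-> ->.
  case: zR; case: e' => [|c e'] // [se] sRE so' _ /(_ 0 isT) /= cb.
  exfalso; move: hy; rewrite sRE /= => by_.
  have ynb : y != b.
    apply: contraTneq pstack => yb; rewrite sRE /is_permutation cat_uniq.
    by apply/negP=> /andP[/and3P[_ /hasPn /(_ b (mem_head _ _))]]; rewrite /= -yb ysL.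
  apply: (av y b c) => //; last by rewrite ltn_neqAle eq_sym ynb.
  by apply: sub3 => //; rewrite sRE /= !eqxx sub0seq.
move: hy pstack; rewrite sRE /= => xy pstack.
have yxne : y != x.
  apply: contraTneq pstack => yx; rewrite /is_permutation cat_uniq.
  by apply/negP=> /andP[/and3P[_ /hasPn /(_ x (mem_head _ _))]]; rewrite /= -yx ysL.
(* [m] is the largest letter of the image of [L], so [x < y <= m]. *)
have xm : x < m.
  have : x < y by rewrite ltn_neqAle eq_sym yxne.
  move/leq_trans; apply; move: ysL; rewrite (perm_mem (zigzag_perm zL)) in_cons.
  by case/orP => [/eqP->//|/(allP (zigzag_max zL))/ltnW].
have mn : m < n.
  apply: (allP hall); rewrite mem_cat -(perm_mem (stack_sort_perm pL)).
  by rewrite (perm_mem (zigzag_perm zL)) mem_head.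
exists (rcons e x), (rcons o m), n; apply: zigzag_step => //.
(* If some [e_i] exceeded [x], then [o_i e_i x] would be a 321 pattern. *)
apply/(all_nthP 0) => i ie.
have [eo sLE _ _ /(_ i)] := zL; rewrite -eo => /(_ ie) ei.
rewrite ltnNge; apply/negP => xle.
have nthL : subseq [:: nth 0 o i; nth 0 e i] (stack_sort L).
  rewrite sLE; apply: subseq_trans (subseq_rcons _ _).
  have := ie; elim: (o) (e) i eo {ei sLE zL xle ie} => [|a o1 IH] [|b e1] //= [|i] [eo].
    by rewrite /= !eqxx sub0seq.
  rewrite ltnS /= => /IH - /(_ eo) h.
  exact: subseq_trans h (subseq_trans (subseq_cons _ b) (subseq_cons _ a)).
have einx : nth 0 e i != x.
  apply: contraTneq pstack => ex; rewrite /is_permutation cat_uniq.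
  apply/negP=> /andP[/and3P[_ /hasPn /(_ x (mem_head _ _))]] /=.
  by rewrite (mem_subseq nthL) // -ex !inE eqxx orbT.
apply: (av (nth 0 o i) (nth 0 e i) x) => //; last by rewrite ltn_neqAle eq_sym einx.
rewrite -[[:: _; _; x]]/([:: nth 0 o i; nth 0 e i] ++ [:: x]).
by apply: cat_subseq => //; rewrite sub1seq sRE mem_head.
Qed.

(** * Zigzags are uniquely sorted and avoid 321 *)

(** Write [w = u x n] with [u] a shorter zigzag ending in [m > x]. In a preimage [L n R] of [w], the
    images of [L] and [R] concatenate to [u x]; the descent from [m] to [x] forces the cut between
    them, so [R] is [x] and [L] is the unique preimage of [u]. *)
Lemma zigzag_uniquely_sorted w e o m : is_permutation w -> zigzag w e o m ->
  uniquely_sorted w.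
Proof.
elim/last_ind: o w e m => [|o m IH] w e n pw.
  case=> _ /= wE _ _ _; rewrite wE in pw *; exists [:: n].
  split=> [|v [pv /(stack_sort_eq_seq1 pv)->] //]; split=> //.
  by rewrite -[[:: n]]/([::] ++ n :: [::]) stack_sort_cat // stack_sort_nil.
case/lastP: e => [[]|e x]; first by rewrite size_rcons.
move=> z; have zm := zigzag_max z; have zp := zigzag_perm z.
have [[u zu wE] xm mn ex] := zigzag_unstep z.
have pux : is_permutation (u ++ [:: x]).
  by move: pw; rewrite wE -cat_rcons -cats1 => /is_permutation_cat_cons[].
have pu : is_permutation u by have [] := is_permutation_cat_cons pux.
have px : is_permutation [:: x].
  by move: pux; rewrite /is_permutation all_cat => /andP[_ /andP[_]].
have [v [[pv sv] vU]] := IH _ _ _ pu zu.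
have sx : stack_sort [:: x] = [:: x].
  by rewrite -[[:: x]]/([::] ++ x :: [::]) stack_sort_cat // stack_sort_nil.
have vu : perm_eq v u by rewrite -sv perm_sym stack_sort_perm.
have uxn : all (fun y => y < n) (u ++ [:: x]).
  have : perm_eq (n :: (u ++ [:: x])) (n :: (rcons e x ++ rcons o m)).
    by apply: perm_trans zp; rewrite wE (perm_catCA [:: n] u) perm_cat // (perm_catC [:: n]).
  by rewrite perm_cons => /perm_all->.
exists (v ++ n :: [:: x]); split.
  split.
    rewrite (is_permutation_perm (v := w)) // wE.
    by apply: perm_cat => //; rewrite (perm_catC [:: n] [:: x]).
  rewrite stack_sort_cat ?sv ?sx ?wE //.
  by rewrite (perm_all _ (perm_cat vu (perm_refl [:: x]))).
move=> t [pt]; rewrite wE -cat_rcons cats1.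
case/(stack_sort_last_max pt) => L [R [tE hLR uE pL pR]].
have umE : u = rcons (weave o e) m by case: zu.
(* If [R] is empty, the image of [L] ends in [x], its largest letter, yet contains [m > x]. *)
have [R0|R0] := eqVneq R [::].
  move: uE; rewrite R0 stack_sort_nil cats0 => /esym.
  case/(stack_sort_last_max pL) => A [B [_ hAB uE pA pB]].
  have : m \in A ++ B.
    rewrite mem_cat -(perm_mem (stack_sort_perm pA)).
    rewrite -(perm_mem (stack_sort_perm pB)) -mem_cat -uE umE.
    by rewrite mem_rcons mem_head.
  by move=> /(allP hAB); rewrite ltnNge ltnW.
move: uE; case/lastP E: (stack_sort R) => [|r x'].
  by rewrite (stack_sort_eq_nil pR E) in R0.
rewrite -rcons_cat => /rcons_inj[uE xx']; rewrite -xx' in E.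
have [A [B [_ hAB rE pA pB]]] := stack_sort_last_max pR E.
(* Were the image of [R] longer than one letter, it would end in [m x], although its last letter is
   its largest. *)
have r0 : r = [::].
  case/lastP: r uE E rE => // r m'; rewrite umE -rcons_cat => /rcons_inj[_ <-] E rE.
  have : m \in A ++ B.
    rewrite mem_cat -(perm_mem (stack_sort_perm pA)).
    by rewrite -(perm_mem (stack_sort_perm pB)) -mem_cat -rE mem_rcons mem_head.
  by move=> /(allP hAB); rewrite ltnNge ltnW.
move: uE E; rewrite r0 cats0 => uE /(stack_sort_eq_seq1 pR) RE.
by rewrite tE RE (vU L).
Qed.

(** In a word without repetitions a subsequence is the filter of the word by its letters, so two
    letters of [s] occur in the same order in [s] and in [w]. *)
Lemma sorted_subseq_pair s w a b : uniq w -> subseq s w -> sorted ltn s ->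
  subseq [:: a; b] w -> a \in s -> b \in s -> a < b.
Proof.
move=> uw sw ss abw ia ib.
have sE := subseq_uniqP uw sw.
have : subseq (filter [in s] [:: a; b]) s.
  rewrite [X in subseq _ X]sE subseq_filter filter_all.
  exact: subseq_trans (filter_subseq _ _) abw.
by rewrite /= ia ib => /(subseq_sorted ltn_trans) /(_ ss) /andP[].
Qed.

(** Pigeonhole: [w] is covered by the two increasing subsequences [e] and [rcons o m], so two
    letters of a decreasing triple would lie in one of them. *)
Lemma zigzag_avoids w e o m : uniq w -> zigzag w e o m -> avoids [:: 3; 2; 1] w.
Proof.
move=> uw z; have zp := zigzag_perm z.
have [eo wE so se _] := z; apply/avoids_321 => a b c abc ba cb.
have /andP[ow ew] := subseq_weave eo.
have sow : subseq (rcons o m) w by rewrite wE -!cats1 cat_subseq.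
have sew : subseq e w by rewrite wE (subseq_trans ew) ?subseq_rcons.
have cls t : t \in [:: a; b; c] -> (t \in e) || (t \in rcons o m).
  move=> /(mem_subseq abc); rewrite (perm_mem zp) mem_rcons !in_cons mem_cat.
  by rewrite orbCA.
have sub2 s : subseq s [:: a; b; c] -> subseq s w by move/subseq_trans; apply.
have ab : subseq [:: a; b] w by apply: sub2; rewrite /= !eqxx.
have bc : subseq [:: b; c] w by apply: sub2; exact: subseq_cons.
have ac : subseq [:: a; c] w.
  by apply: sub2; rewrite /= eqxx; case: ifP; rewrite ?eqxx.
have contra s t1 t2 : subseq s w -> sorted ltn s -> subseq [:: t1; t2] w ->
    t2 < t1 -> t1 \in s -> t2 \in s -> False.
  move=> sw ss st lt12 i1 i2.
  by have := sorted_subseq_pair uw sw ss st i1 i2; rewrite ltnNge ltnW.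
have ca := ltn_trans cb ba.
have [] := (cls a, cls b, cls c); rewrite !inE !eqxx !orbT.
move=> [/(_ isT)/orP[]ia /(_ isT)/orP[]ib] /(_ isT)/orP[]ic.
all: by [apply: (contra _ _ _ sew se ab) | apply: (contra _ _ _ sew se bc)
        | apply: (contra _ _ _ sew se ac) | apply: (contra _ _ _ sow so ab)
        | apply: (contra _ _ _ sow so bc) | apply: (contra _ _ _ sow so ac)].
Qed.

(** * Standard Young tableaux with two rows *)

(** Rows of unequal length are allowed because deleting the largest letter leaves the rectangular
    shapes. *)
Definition two_row_tableau (n b : nat) (p : seq nat * seq nat) : Prop :=
  [/\ perm_eq (p.1 ++ p.2) (iota 1 n), sorted ltn p.1, sorted ltn p.2,
      size p.2 = b & size p.2 <= size p.1 /\ dominated p.1 p.2].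

(** The largest letter ends one of the two rows. The test [n < 2 * b] discards shapes whose second
    row would be longer than the first. *)
Fixpoint two_row_tableaux (n b : nat) : seq (seq nat * seq nat) :=
  match n with
  | 0 => if b is 0 then [:: ([::], [::])] else [::]
  | n'.+1 =>
      if n < 2 * b then [::]
      else [seq (rcons p.1 n, p.2) | p <- two_row_tableaux n' b] ++
        (if b is b'.+1 then
           [seq (p.1, rcons p.2 n) | p <- two_row_tableaux n' b'] else [::])
  end.

Lemma sorted_ltn_max s m : sorted ltn s -> all (fun y => y <= m) s -> m \in s ->
  exists s', s = rcons s' m.
Proof.
case/lastP: s => // s x; rewrite sorted_ltn_rcons all_rcons => /andP[_ /allP sx].
case/andP=> xm _; rewrite mem_rcons in_cons => /orP[/eqP->|/sx]; first by exists s.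
by rewrite ltnNge xm.
Qed.

#[local] Arguments iota : simpl never.

Lemma iota1S n : iota 1 n.+1 = rcons (iota 1 n) n.+1.
Proof. by rewrite -{1}(addn1 n) iotaD cats1. Qed.

Lemma two_row_tableau_size n b p : two_row_tableau n b p ->
  size p.1 + b = n /\ 2 * b <= n.
Proof.
case=> /perm_size; rewrite size_cat size_iota => sn _ _ sb [le _].
move: sn sb le; rewrite /=; lia.
Qed.

Lemma two_row_tableau_lt n b p : two_row_tableau n b p ->
  all (fun y => y < n.+1) p.1 && all (fun y => y < n.+1) p.2.
Proof.
case=> /perm_all; rewrite -all_cat => -> _ _ _ _.
by apply/allP => y; rewrite mem_iota; lia.
Qed.

Lemma two_row_tableau_rcons1 n b e o :
  two_row_tableau n b (e, o) -> two_row_tableau n.+1 b (rcons e n.+1, o).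
Proof.
move=> t; have /andP[/= he _] := two_row_tableau_lt t; case: t => /= pe se so sb [le d].
split=> //=; last 1 first.
- split; first by rewrite size_rcons ltnW.
  by move=> i io; rewrite nth_rcons (leq_trans io le) d.
- by rewrite iota1S perm_sym perm_rcons cat_rcons perm_sym -cat1s perm_catCA /= perm_cons.
- by rewrite sorted_ltn_rcons se.
Qed.

Lemma two_row_tableau_rcons2 n b e o : 2 * b.+1 <= n.+1 ->
  two_row_tableau n b (e, o) -> two_row_tableau n.+1 b.+1 (e, rcons o n.+1).
Proof.
move=> bn t; have /andP[/= /allP he ho] := two_row_tableau_lt t.
have [/= sz _] := two_row_tableau_size t.
(* The bound on [b] makes the second row strictly shorter, so the new cell lies under an existing
   one. *)
case: t => /= pe se so sb [le d]; have oe : size o < size e by lia.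
split=> //=; last 1 first.
- split; first by rewrite size_rcons.
  move=> i; rewrite size_rcons ltnS nth_rcons => io; case: (ltngtP i) io => // [io _|-> _]; first exact: d.
  by apply: he; rewrite mem_nth.
- by rewrite iota1S -rcons_cat perm_rcons perm_sym perm_rcons perm_cons perm_sym.
- by rewrite sorted_ltn_rcons so.
- by rewrite size_rcons sb.
Qed.

Lemma two_row_tableau_inv n b e o : two_row_tableau n.+1 b (e, o) ->
  (exists2 e', e = rcons e' n.+1 & two_row_tableau n b (e', o)) \/
  (exists o' b', [/\ o = rcons o' n.+1, b = b'.+1 & two_row_tableau n b' (e, o')]).
Proof.
move=> t; have /andP[/= he ho] := two_row_tableau_lt t.
case: t => /= pe se so sb [le d].
have : n.+1 \in e ++ o by rewrite (perm_mem pe) mem_iota; lia.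
rewrite mem_cat => /orP[/(sorted_ltn_max se he)[e' eE]|/(sorted_ltn_max so ho)[o' oE]].
  left; exists e' => //; rewrite eE in pe se le d he *.
  move: se; rewrite sorted_ltn_rcons => /andP[se lte].
  (* Otherwise the column of the deleted letter [n.+1] would hold a still larger letter in the
     second row. *)
  have oe : size o <= size e'.
    rewrite leqNgt; apply/negP => lt; rewrite size_rcons in le.
    have := d _ lt; rewrite nth_rcons ltnn eqxx ltnNge => /negP; apply.
    by rewrite -ltnS; apply: (allP ho); rewrite mem_nth.
  split=> //=; last first.
    by split=> // i io; have := d i io; rewrite nth_rcons (leq_trans io oe).
  move: pe; rewrite iota1S perm_sym perm_rcons cat_rcons perm_sym.
  by rewrite -cat1s perm_catCA /= perm_cons.
right; exists o', (size o'); rewrite oE size_rcons in pe so sb le d *.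
move: so; rewrite sorted_ltn_rcons => /andP[so _].
split=> //; split=> //=; last first.
  split=> [|i io]; first exact: ltnW.
  by have := d i; rewrite size_rcons nth_rcons io ltnS ltnW //; apply.
by move: pe; rewrite iota1S -rcons_cat perm_rcons perm_sym perm_rcons perm_cons perm_sym.
Qed.

Lemma mem_two_row_tableaux n b p :
  p \in two_row_tableaux n b <-> two_row_tableau n b p.
Proof.
elim: n b p => [|n IH] b [e o].
  split; first by case: b => //=; rewrite inE => /eqP[-> ->]; split.
  case=> /= /perm_nilP; case: e => //= -> _ _ <- _.
  by rewrite mem_head.
split=> [|t].
  rewrite [two_row_tableaux _ _]/=; case: ifPn => //; rewrite -leqNgt => bn.
  rewrite mem_cat => /orP[/mapP[[e' o'] /IH t [-> ->]]|].
    exact: two_row_tableau_rcons1.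
  case: b bn => // b bn /mapP[[e' o'] /IH t [-> ->]].
  exact: two_row_tableau_rcons2.
have [_ bn] := two_row_tableau_size t.
rewrite [two_row_tableaux _ _]/= ltnNge bn /= mem_cat; apply/orP.
have [[e' -> /IH t']|[o' [b' [-> -> /IH t']]]] := two_row_tableau_inv t.
  by left; apply/mapP; exists (e', o).
by right; apply/mapP; exists (e, o').
Qed.

Lemma uniq_two_row_tableaux n b : uniq (two_row_tableaux n b).
Proof.
elim: n b => [|n IH] b; first by case: b.
rewrite [two_row_tableaux _ _]/=; case: ifP => // _; rewrite cat_uniq map_inj_uniq ?IH /=; last first.
  by move=> [e o] [e' o'] /= [/rcons_inj[->] ->].
case: b => // b; rewrite map_inj_uniq ?IH ?andbT; last first.
  by move=> [e o] [e' o'] /= [-> /rcons_inj[->]].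
apply/hasPn => _ /mapP[[e o] /mem_two_row_tableaux t ->]; apply/mapP => -[[e' o'] _ [eE _]].
have /andP[/= /allP/(_ n.+1) + _] := two_row_tableau_lt t.
by rewrite eE mem_rcons mem_head ltnn => /(_ isT).
Qed.

(* The bound includes [2 * b = n.+1], where the tableaux are empty and the two
   binomials agree: this is the boundary case of the recurrence. *)
Lemma size_two_row_tableaux n b : 2 * b <= n.+1 ->
  size (two_row_tableaux n b) + (if b is b'.+1 then 'C(n, b') else 0) = 'C(n, b).
Proof.
elim: n b => [|n IH] b bn; first by case: b bn => // b; lia.
rewrite [two_row_tableaux _ _]/=; case: ifPn => [lt|]; last first.
  rewrite -leqNgt => {}bn; rewrite size_cat size_map.
  (* Pascal's rule splits both binomials, and the induction hypotheses for the two row lengths add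
     up to the claim. *)
  have := IH b bn; case: b bn => [|b] bn; first by rewrite !bin0 /= !addn0.
  rewrite size_map !binS => <-; have := IH b; case: b bn => [|b] bn.
    by rewrite !bin0 => <- //; lia.
  by rewrite binS => <-; lia.
case: b bn lt => // b bn lt; rewrite add0n.
by rewrite -bin_sub; [congr 'C(_, _); lia | lia].
Qed.

(** For positive [k] the count is the ballot number $\binom{2k}{k}-\binom{2k}{k-1}$, and
    $k\binom{2k}{k}=(k+1)\binom{2k}{k-1}$ turns it into $\frac{1}{k+1}\binom{2k}{k}$. *)
Lemma size_two_row_tableaux_catalan k :
  size (two_row_tableaux (2 * k) k) = catalan k.
Proof.
apply/eqP; rewrite -(eqn_pmul2l (ltn0Sn k)) catalanE; apply/eqP.
have := @size_two_row_tableaux (2 * k) k (leqnSn _).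
case: k => [|k] // h.
have := mul_bin_left (2 * k.+1) k; nia.
Qed.

(** * From words to tableaux *)

Lemma mem_uniquely_sorted_avoiding k w :
  uniquely_sorted_avoiding (2 * k + 1) [:: 3; 2; 1] w <->
  exists2 p, two_row_tableau (2 * k) k p &
    w = rcons (weave p.2 p.1) (2 * k).+1.
Proof.
have perm_word : perm_eq w (iota 1 (2 * k + 1)) -> is_permutation w.
  move=> pw; rewrite (is_permutation_perm pw) /is_permutation iota_uniq /=.
  by apply/allP => x; rewrite mem_iota => /andP[].
split=> [[pw us av]|[[e o] /= [/= pe se so so' [le d]] wE]].
  have [v [[pv vw] _]] := us; rewrite -vw in us av.
  have v0 : v != [::].
    by apply: contraTneq pw => v0; rewrite -vw v0 stack_sort_nil addn1; apply/negP => /perm_size.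
  have [e [o [m z]]] := zigzag_of_uniquely_sorted pv v0 us av.
  rewrite vw in z; have zm := zigzag_max z; have zp := zigzag_perm z.
  have peo : perm_eq (m :: (e ++ o)) (iota 1 (2 * k + 1)).
    by apply: perm_trans pw; rewrite perm_sym.
  (* The last letter is the largest one, so the two rows use exactly the letters from 1 to
     [2 * k]. *)
  have mE : m = (2 * k).+1.
    apply/eqP; rewrite eqn_leq; apply/andP; split.
      have := mem_head m (e ++ o); rewrite (perm_mem peo) mem_iota.
      by rewrite add1n addn1 => /andP[].
    have : (2 * k).+1 \in m :: (e ++ o).
      by rewrite (perm_mem peo) mem_iota addn1 add1n ltnSn.
    by rewrite in_cons => /orP[/eqP->|/(allP zm)/ltnW].
  have [eo wE so se d] := z; exists (e, o); last by rewrite -mE.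
  move: peo; rewrite mE addn1 iota1S perm_sym perm_rcons perm_cons perm_sym => peo.
  move: so; rewrite sorted_ltn_rcons => /andP[so _].
  split=> //=; last by rewrite eo.
  by have := perm_size peo; rewrite size_cat size_iota eo /=; lia.
have eo : size e = size o.
  by have := perm_size pe; rewrite size_cat size_iota /=; lia.
have z : zigzag w e o (2 * k).+1.
  split=> //; rewrite sorted_ltn_rcons so /=; apply/allP => y yo.
  by have := perm_mem pe y; rewrite mem_cat yo orbT mem_iota => /esym/andP[].
have pw : perm_eq w (iota 1 (2 * k + 1)).
  apply: perm_trans (zigzag_perm z) _.
  by rewrite addn1 iota1S perm_sym perm_rcons perm_cons perm_sym.
have pw' := perm_word pw.
split=> //; first exact: zigzag_uniquely_sorted z.
by apply: zigzag_avoids z; case/andP: pw'.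
Qed.

Lemma card_eq_seq (T : choiceType) (A : set T) (s : seq T) : uniq s ->
  (forall x, A x <-> x \in s) -> (A #= `I_(size s))%card.
Proof.
move=> us As; apply/card_set_bijP; exists (index^~ s); split.
- by move=> x /As /=; rewrite index_mem.
- by move=> x y; rewrite !inE => /As xs /As ys; apply: index_inj.
(* The case split on [s] supplies a default letter for [nth]; the bound on [i] excludes the empty
   list. *)
- by move=> i /= lt; case: s us As lt => // z s us As lt;
    exists (nth z (z :: s) i); [apply/As; rewrite mem_nth | rewrite index_uniq].
Qed.

Theorem theorem9p1 (k : nat) :
  (uniquely_sorted_avoiding (2 * k + 1) [:: 3; 2; 1] #= `I_(catalan k))%card.
Proof.
pose word p := rcons (weave p.2 p.1) (2 * k).+1.
rewrite -size_two_row_tableaux_catalan -(size_map word).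
apply: card_eq_seq => [|w].
  rewrite map_inj_in_uniq ?uniq_two_row_tableaux //.
  move=> [e o] [e' o'] /mem_two_row_tableaux t /mem_two_row_tableaux t'.
  (* Weaving is injective on rows of equal length; the size count for shape [(k, k)] provides
     this. *)
  move=> /rcons_inj[/weave_inj H].
  have [/= s1 _] := two_row_tableau_size t; have [/= s2 _] := two_row_tableau_size t'.
  case: t t' => /= _ _ _ so _ [/= _ _ _ so' _].
  by have [||-> ->] := H; first [lia | done].
rewrite mem_uniquely_sorted_avoiding; split.
  by case=> p /mem_two_row_tableaux tp ->; apply/mapP; exists p.
by case/mapP => p /mem_two_row_tableaux tp ->; exists p.
Qed.
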